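(* Let $r$ be a positive integer and let $w$ be a finite word over $\{0,1\}$. If $\widetilde w$ is the word obtained by reversing the order of the bits of $w$, then $R_{0,0}(w,r)=R_{0,0}(\widetilde w,r)$ in $\mathbb{Z}[Y][[X]]$.
   Context: Given a finite word $w$ over $\{0,1\}$, extend it to a doubly infinite bit sequence $s:\mathbb{Z}\to\{0,1\}$ by adding infinitely many bits $0$ on its left and infinitely many bits $0$ on its right. A placement of $n$ $r$-ribbons (below the lattice path described by $s$: a unit step right for each bit $0$ and up for each bit $1$, read from left to right) is a sequence of positions $i_1<i_2<\cdots<i_n$ in $\mathbb{Z}$ such that one can successively, for $t=1,2,\dots,n$, perform the following change: the current bit sequence $s^{(t-1)}$ (with $s^{(0)}=s$) satisfies $s^{(t-1)}_{i_t-r}=1$ and $s^{(t-1)}_{i_t}=0$, and $s^{(t)}$ is obtained from it by setting the bit at $i_t-r$ to $0$ and the bit at $i_t$ to $1$. The height of the $t$-th ribbon is $\sum_{j=1}^{r-1}s^{(t-1)}_{i_t-j}$, and the total height of the placement is the sum of the heights of its $n$ ribbons. Then $$R_{0,0}(w,r)=\sum X^nY^{h},$$ the sum being over all placements of $r$-ribbons (all $n\ge0$, including the empty placement), where $n$ is the number of ribbons and $h$ the total height of the placement. (For each $n$ there are finitely many placements, so this is an element of $\mathbb{Z}[Y][[X]]$.) *)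

(* Defs.v *)
From mathcomp Require Import all_boot all_order all_algebra.
From mathcomp Require Import finmap.
From mathcomp Require Import boolp classical_sets functions cardinality fsbigop.

Set Implicit Arguments.
Unset Strict Implicit.
Unset Printing Implicit Defensive.

Import Order.TTheory GRing.Theory Num.Theory.

Local Open Scope classical_set_scope.
Local Open Scope ring_scope.

(* A[[X]], a series being identified with its sequence of coefficients:
   f n is the coefficient of X^n. *)
Definition fps (A : nzRingType) := nat -> A.

(* Bit 1 is true. The first letter of w is put at position 0; all the other
   positions outside w carry the bit 0. *)
Definition bits_of_word (w : seq bool) : int -> bool :=
  fun k => if k is Posz m then nth false w m else false.

Definition can_add_ribbon (r : nat) (s : int -> bool) (i : int) : bool :=
  s (i - r%:Z) && ~~ s i.

Definition add_ribbon (r : nat) (s : int -> bool) (i : int) : int -> bool :=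
  fun k => if k == i - r%:Z then false else if k == i then true else s k.

Definition ribbon_height (r : nat) (s : int -> bool) (i : int) : nat :=
  (\sum_(1 <= j < r) s (i - j%:Z)%R)%N.

Fixpoint addable (r : nat) (s : int -> bool) (p : seq int) : bool :=
  if p is i :: p' then can_add_ribbon r s i && addable r (add_ribbon r s i) p'
  else true.

Fixpoint total_height (r : nat) (s : int -> bool) (p : seq int) : nat :=
  if p is i :: p' then
    (ribbon_height r s i + total_height r (add_ribbon r s i) p')%N
  else 0%N.

Definition placements (r : nat) (s : int -> bool) (n : nat) : set (seq int) :=
  [set p | [/\ size p = n, sorted <%R p & addable r s p]].

(* The inner polynomial variable 'X of {poly int} is Y. The sum is over a
   finite set, see finite_placements below. *)
Definition R00 (w : seq bool) (r : nat) : fps {poly int} :=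
  fun n => \sum_(p \in placements r (bits_of_word w) n)
             ('X^(total_height r (bits_of_word w) p) : {poly int}).

Lemma addable_bounded (r : nat) (s : int -> bool) (p : seq int) (M : nat) :
  (forall k, s k -> 0 <= k < M%:Z) -> addable r s p ->
  all (fun i : int => 0 <= i < (M + size p * r)%N%:Z) p.
Proof.
elim: p s M => [//|i p IH] s M sM /= /andP[/andP[/sM sir _] ap].
have lei : 0 <= i < (M + r)%N%:Z.
  move: sir => /andP[h1 h2]; rewrite subr_ge0 in h1.
  by rewrite (le_trans _ h1) //= PoszD -ltrBlDr.
apply/andP; split.
  case/andP: lei => -> /= /lt_le_trans; apply.
  by rewrite lez_nat mulSn addnA leq_addr.
rewrite mulSn addnA; apply: IH ap => k; rewrite /add_ribbon.
case: eqP => // _; case: eqP => [->//|_ /sM /andP[-> /= /lt_le_trans]]; apply.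
by rewrite lez_nat leq_addr.
Qed.

Lemma finite_placements (r : nat) (w : seq bool) (n : nat) :
  finite_set (placements r (bits_of_word w) n).
Proof.
pose B := (size w + n * r)%N.
pose f (t : n.-tuple 'I_B) : seq int := [seq (nat_of_ord i)%:Z | i : 'I_B <- t].
apply: (@sub_finite_set _ _ (f @` setT)); last first.
  by apply: finite_image; exact: finite_finset.
move=> p [sp _ /(@addable_bounded _ _ _ (size w)) bp].
have {bp} : all (fun i : int => 0 <= i < B%:Z) p.
  rewrite /B -sp; apply: bp => -[k|//] /= sk; rewrite ltz_nat /=.
  by rewrite ltnNge; apply/negP => h; rewrite nth_default in sk.
move=> bp; have [q [sq <-]] : exists q : seq 'I_B,
    size q = n /\ [seq (nat_of_ord i)%:Z | i : 'I_B <- q] = p.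
  move: B bp {f} => B bp; elim: p n sp bp => [|i p IH] m /=; first by move=> <-; exists [::].
  move=> <- /andP[iB /(IH _ erefl)[q [sq qp]]].
  case: i iB => [k|//]; rewrite ltz_nat => /andP[_ kB].
  by exists (Ordinal kB :: q); rewrite /= sq qp.
by move/eqP: sq => sq; exists (Tuple sq).
Qed.

(* Main.v *)
(** Scan the positions from left to right, deciding at each one whether to add
a ribbon. The only memory needed is the window [u] of the [r] current bits just
behind the scanning position, so [R00 w r] is obtained by a transfer matrix
reading the letters of [w] from the window [0^r]. After the last letter of [w]
the series depends only on the number [k] of bits 1 in the window, and equals
[g_k = \prod_(j < k) 1 / (1 - X Y^j)]: indeed [g_(k+1) = g_k + X Y^k g_(k+1)].

Similarly, when [r] letters are read, step [j] only involves the pair formed by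
bit [j] of the window and letter [j], and acts on [k] alone. From this one gets
that the last [r + 1] letters of the word being read satisfy the mirror image
of the recursion on its first letter ([window_series_rev]). Hence reading [w]
from [u] gives the same series as reading [rev w ++ rev u] from [0^r], and
[u = 0^r] is the theorem. *)
Require Import Defs.
From mathcomp Require Import all_boot all_order all_algebra.
From mathcomp Require Import boolp classical_sets functions fsbigop.
From mathcomp Require Import zify.

Set Implicit Arguments.
Unset Strict Implicit.
Unset Printing Implicit Defensive.

Import Order.TTheory GRing.Theory Num.Theory.

Local Open Scope ring_scope.

(** * Series in [X] and the window scan *)

Notation series := (nat -> {poly int}).

Definition mulXY (k : nat) (f : series) : series :=
  fun n => if n is m.+1 then 'X^k * f m else 0.

Lemma mulXYD k (f g : series) : mulXY k (f + g) = mulXY k f + mulXY k g.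
Proof.
apply/funext => -[|n]; first by rewrite /= [RHS]addr0.
exact: mulrDr.
Qed.

Lemma mulXYA k l k' l' f : (k + l = k' + l')%N ->
  mulXY k (mulXY l f) = mulXY k' (mulXY l' f).
Proof.
move=> e; apply/funext => -[|[|n]] //=; first by rewrite !mulr0.
by rewrite !mulrA -!exprD e.
Qed.

(* The product of the series 1 / (1 - X Y^j) for j < k. *)
Fixpoint tail_series (k : nat) : series :=
  if k is k'.+1 then
    fix h n := tail_series k' n + (if n is m.+1 then 'X^k' * h m else 0)
  else fun n => (n == 0)%:R.

Lemma tail_seriesS k :
  tail_series k.+1 = tail_series k + mulXY k (tail_series k.+1).
Proof. by apply/funext => -[|n]. Qed.

(* [u] is the window behind the scanning position; [w] is still to be read and
   is followed by infinitely many bits 0. *)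
Fixpoint window_series (u w : seq bool) : series :=
  if w is b :: w' then
    let u' := behead u in
    if head false u && ~~ b then
      window_series (rcons u' false) w' +
      mulXY (count id u') (window_series (rcons u' true) w')
    else window_series (rcons u' b) w'
  else tail_series (count id u).

(* [window_series u w] when [size u = size w], with [ps = zip u w] and [k] the
   number of bits 1 in [u]: see [window_series_zip]. *)
Fixpoint pair_series (k : nat) (ps : seq (bool * bool)) : series :=
  if ps is (a, b) :: ps' then
    if a && ~~ b then pair_series k.-1 ps' + mulXY k.-1 (pair_series k ps')
    else pair_series ((~~ a && b) + k) ps'
  else tail_series k.

(** Pairs (0,0) and (1,1) keep [k], and a final (1,0) is absorbed by [tail_seriesS]. The bound keeps
    [k.-1] from truncating at 0. *)
Lemma pair_series_rcons_stable k ps a b : a || ~~ b ->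
  (count fst ps + (a && ~~ b) <= k)%N ->
  pair_series k (rcons ps (a, b)) = pair_series k ps.
Proof.
move=> ab; elim: ps k => [|[c d] ps IH] k /=.
  case: a ab; case: b => //= _; case: k => // k _.
  by rewrite [RHS]tail_seriesS.
by case: c => /=; case: d => /= hk; rewrite ?IH //; lia.
Qed.

(** By [tail_seriesS] the final pair (0,1) splits off a term with factor X Y^l, where l is the count
    reached. Each earlier ribbon raises l by one; starting from [k.+1] raises the height of each
    ribbon by one instead, so the total power of Y agrees. *)
Lemma pair_series_rcons01 m ps (k := (m + count fst ps)%N) :
  pair_series k (rcons ps (false, true)) =
  pair_series k ps + mulXY (m + count snd ps) (pair_series k.+1 ps).
Proof.
rewrite {}/k; elim: ps m => [|[a b] ps IH] m /=.
  by rewrite addn0 -tail_seriesS.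
case: a; case: b => /=; rewrite ?add0n.
- by rewrite !(addnCA m 1) !add1n -!addSn IH.
- rewrite !(addnCA m 1) !add1n IH /= -!addSn IH !mulXYD -!addrA; congr (_ + _).
  rewrite addrCA; congr (_ + (_ + _)); apply: mulXYA; lia.
- by rewrite !(addnCA m 1) !add1n -!addSn IH.
- by rewrite IH.
Qed.

(** While [v] is read, only bits of [u] leave the window; the new bits enter after [y] and matter
    only through their number. *)
Lemma window_series_cat u y v : size u = size v ->
  window_series (u ++ y) v = pair_series (count id (u ++ y)) (zip u v).
Proof.
elim: v u y => [|b v IH] [|a u] y //= [suv].
have E c : count id (u ++ rcons y c) = (c + count id (u ++ y))%N.
  by rewrite !count_cat -cats1 count_cat /= addn0; lia.
rewrite !rcons_cat !IH // !E.
by case: a; case: b.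
Qed.

Lemma window_series_zip u v : size u = size v ->
  window_series u v = pair_series (count id u) (zip u v).
Proof. by move=> suv; rewrite -{1 2}[u]cats0 window_series_cat. Qed.

(** The recursions at the two ends of the word are linear with commuting factors, which reduces the
    claim to an empty prefix [x]. *)
Lemma window_series_rev x v a b u : size v = (size u).+1 ->
  window_series v (x ++ b :: rev (a :: u)) =
  if a && ~~ b then
    window_series v (x ++ rev (rcons u false)) +
    mulXY (count id u) (window_series v (x ++ rev (rcons u true)))
  else window_series v (x ++ rev (rcons u b)).
Proof.
move=> svu; elim: x v svu => [|d x IH] v svu /=; last first.
  have sz c : size (rcons (behead v) c) = (size u).+1.
    by rewrite size_rcons size_behead svu.
  rewrite !IH //; case: (a && ~~ b) => //; case: (head false v && ~~ d) => //.
  rewrite !mulXYD -!addrA; congr (_ + _).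
  by rewrite addrCA; congr (_ + (_ + _)); apply: mulXYA; rewrite addnC.
case: v svu => [//|c v] [svu]; rewrite !rev_rcons rev_cons -/(behead (c :: v)).
have su : size v = size (rev u) by rewrite size_rev.
rewrite -(count_rev id u); move: (rev u) su => {svu}u su.
rewrite !window_series_zip ?size_rcons /= ?su //.
(* The bit [d] stored at the first letter leaves the window exactly when the last letter [a] is
   read. *)
have zipE d : zip (rcons v d) (rcons u a) = rcons (zip v u) (d, a).
  by rewrite zip_rcons.
have cv : count fst (zip v u) = count id v.
  by rewrite -[in RHS](unzip1_zip (eq_leq su)) count_map.
have cu : count snd (zip v u) = count id u.
  by rewrite -[in RHS](unzip2_zip (eq_leq (esym su))) count_map.
have cr d : count id (rcons v d) = (d + count id v)%N.
  by rewrite -cats1 count_cat /= addn0 addnC.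
have U := pair_series_rcons01 0 (zip v u); rewrite cv cu !add0n in U.
have st d : d || ~~ a ->
    pair_series (d + count id v) (rcons (zip v u) (d, a)) =
    pair_series (d + count id v) (zip v u).
  move=> da; rewrite pair_series_rcons_stable // cv addnC leq_add2r.
  by case: (d) (a) => [] [].
rewrite !zipE !cr.
have [s0 s1] := (st false, st true); rewrite add0n in s0; rewrite add1n in s1.
case: a {zipE st} U s0 s1 => U s0 s1; case: b; case: c => //=;
  rewrite ?add0n ?add1n ?U ?s0 ?s1 //.
(* A ribbon is possible at both ends: the two ribbon terms come in opposite order. *)
exact: addrAC.
Qed.

(** * Reversing the word that is read *)

Lemma window_series_shift r u x : size u = r ->
  window_series (nseq r false) (u ++ x) = window_series u x.
Proof.
move=> <-.
suff shift v y : window_series (nseq (size v) false ++ y) (v ++ x) =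
    window_series (y ++ v) x by have := shift u [::]; rewrite cats0.
elim: v y => [|b v IH] y /=; first by rewrite cats0.
by rewrite rcons_cat IH cat_rcons.
Qed.

Lemma window_series_swap r u w : (0 < r)%N -> size u = r ->
  window_series u w = window_series (nseq r false) (rev w ++ rev u).
Proof.
move=> r0; elim: w u => [|b w IH] u su /=.
  by rewrite -[rev u]cats0 window_series_shift ?size_rev //= count_rev.
case: u su => [|a u] /= su; first lia.
rewrite rev_cons cat_rcons window_series_rev ?size_nseq //.
by rewrite !IH ?size_rcons.
Qed.

(** When a bit 1 leaves the window at a letter 0, the two choices recombine by [tail_seriesS]. *)
Lemma window_series_trailing_zeros u m :
  window_series u (nseq m false) = tail_series (count id u).
Proof.
elim: m u => [|m IH] [|a u]; [by []| by [] | exact: IH |].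
rewrite [LHS]/= andbT.
have cr d : count id (rcons u d) = (d + count id u)%N.
  by rewrite -cats1 count_cat /= addn0 addnC.
case: a => /=; last by rewrite IH cr.
by rewrite !IH !cr add0n add1n -tail_seriesS.
Qed.

Lemma window_series_rcons_zeros u w m :
  window_series u (w ++ nseq m false) = window_series u w.
Proof.
elim: w u => [|b w IH] u /=; first exact: window_series_trailing_zeros.
by rewrite !IH.
Qed.

Lemma window_series_zero_rev r w : (0 < r)%N ->
  window_series (nseq r false) (rev w) = window_series (nseq r false) w.
Proof.
move=> r0; rewrite [RHS](@window_series_swap r) ?size_nseq //.
by rewrite rev_nseq window_series_rcons_zeros.
Qed.

(** * Listing the placements *)

Fixpoint placement_list (r : nat) (s : int -> bool) (i : int) (m n : nat) :
    seq (seq int) :=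
  if m is m'.+1 then
    placement_list r s (i + 1) m' n ++
    if n is n'.+1 then
      if can_add_ribbon r s i
      then [seq i :: p | p <- placement_list r (add_ribbon r s i) (i + 1) m' n']
      else [::]
    else [::]
  else if n == 0%N then [:: [::]] else [::].

Lemma mem_placement_list r s i m n p :
  (p \in placement_list r s i m n) =
  [&& size p == n, sorted <%R p, addable r s p &
      all (fun j => i <= j < i + m%:Z) p].
Proof.
elim: m s i n p => [|m IH] s i n p.
  case: p => [|j p] /=; first by case: n.
  rewrite addr0 leNgt; case: (j < i); rewrite /= !andbF; by case: (n == 0%N).
rewrite /= mem_cat IH; case: p => [|j p].
  rewrite /= !andbT; case: n => [|n] //=; case: ifP => // _.
  by rewrite (introF mapP) // => -[].
have cons_mem l : (j :: p \in [seq i :: q | q <- l]) = (j == i) && (p \in l).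
  apply/mapP/andP => [[q ql [-> ->]]|[/eqP -> pl]]; first by rewrite eqxx.
  by exists p.
(* Lists starting at [i] come only from the second half of the enumeration, other nonempty ones only
   from the first. *)
have [->{j cons_mem}|ji] := eqVneq j i.
  have ii : (i + 1 <= i) = false by lia.
  rewrite /= ii !andbF /=.
  case: n => [|n] //=; rewrite eqSS.
  case: (can_add_ribbon r s i); rewrite /= ?andbF ?in_nil //.
  rewrite mem_map => [|x y [] //]; rewrite IH lt_path_sortedE lexx.
  have -> : i < i + m.+1%:Z by lia.
  have -> : all (fun j => i + 1 <= j < i + 1 + m%:Z) p =
      all (> i) p && all (fun j => i <= j < i + m.+1%:Z) p.
    by rewrite -all_predI; apply: eq_all => x /=; lia.
  rewrite /= -!andbA; case: (size p == n) => //=.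
  by case: (all (> i) p); case: (sorted _ p); rewrite ?andbF.
have -> : (j :: p \in
    (if n is n'.+1 then
       if can_add_ribbon r s i
       then [seq i :: q | q <- placement_list r (add_ribbon r s i) (i + 1) m n']
       else [::]
     else [::])) = false.
  by case: n => [|n] //; case: ifP; rewrite // cons_mem (negbTE ji).
rewrite orbF; congr (_ && _); rewrite /= lt_path_sortedE.
case: (boolP (all _ p)) => //= jp; congr (_ && (_ && _)).
have -> : (i + 1 <= j < i + 1 + m%:Z) = (i <= j < i + m.+1%:Z) by lia.
case: (boolP (i <= j < _)) => //= hj; apply: eq_in_all => x /(allP jp).
by lia.
Qed.

Lemma placement_list_uniq r s i m n : uniq (placement_list r s i m n).
Proof.
elim: m s i n => [|m IH] s i n /=; first by case: n.
rewrite cat_uniq IH /=; apply/andP; split; last first.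
  case: n => // n; case: ifP => // _.
  by rewrite map_inj_uniq // => x y [].
apply/hasPn => p; case: n => // n; case: ifP => // _ /mapP[q _ ->].
have ii : (i + 1 <= i) = false by lia.
by rewrite mem_placement_list /= ii !andbF.
Qed.

Definition placement_series r s i m : series :=
  fun n => \sum_(p <- placement_list r s i m n) 'X^(total_height r s p).

Lemma placement_seriesS r s i m :
  placement_series r s i m.+1 = placement_series r s (i + 1) m +
    (if can_add_ribbon r s i
     then mulXY (ribbon_height r s i)
            (placement_series r (add_ribbon r s i) (i + 1) m)
     else 0).
Proof.
apply/funext => n; rewrite /placement_series /= big_cat; congr (_ + _).
case: n => [|n]; first by rewrite big_nil; case: ifP.
case: ifP => _; last by rewrite big_nil.
rewrite big_map /= mulr_sumr; apply: eq_bigr => p _ /=.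
by rewrite exprD.
Qed.

(** [addable_bounded] puts all ribbons below [size w + n * r], so a scan of that length misses
    none. *)
Lemma R00_placement_series w r n m : (size w + n * r <= m)%N ->
  R00 w r n = placement_series r (bits_of_word w) 0 m n.
Proof.
move=> le_m; rewrite /placement_series fsbig_seq ?placement_list_uniq //.
apply: eq_fsbigl; apply/seteqP; split=> p.
  move=> [sp ssp ap]; rewrite /= mem_placement_list sp eqxx ssp ap /= add0r.
  have : all (fun i : int => 0 <= i < (size w + size p * r)%N%:Z) p.
    apply: addable_bounded ap => -[k|//] /= sk; rewrite ltz_nat /=.
    by rewrite ltnNge; apply/negP => h; rewrite nth_default in sk.
  by apply: sub_all => x; rewrite sp; lia.
by rewrite /= mem_placement_list => /and4P[/eqP].
Qed.

(** * From placements to the window series *)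

(* [t] lists the bits of [s] from position [i - r] on, up to trailing zeros. *)
Definition reads (r : nat) (s : int -> bool) (i : int) (t : seq bool) :=
  forall j : nat, s (i - r%:Z + j%:Z) = nth false t j.

Lemma reads_behead r s i t : reads r s i t -> reads r s (i + 1) (behead t).
Proof.
move=> st j; rewrite nth_behead -st; congr (s _); lia.
Qed.

(** Once the window starts at [i + 1 - r], position [i] has index [r.-1], and the erased bit at
    [i - r] has left it. *)
Lemma reads_add_ribbon r s i t : (0 < r)%N -> reads r s i t ->
  reads r (add_ribbon r s i) (i + 1) (set_nth false (behead t) r.-1 true).
Proof.
move=> r0 /reads_behead st j; rewrite /add_ribbon nth_set_nth /= -st.
have -> : (i + 1 - r%:Z + j%:Z == i - r%:Z) = false by lia.
by have -> : (i + 1 - r%:Z + j%:Z == i) = (j == r.-1) by lia.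
Qed.

Lemma sum_nth_count t m :
  (\sum_(0 <= j < m) nth false t j)%N = count id (take m t).
Proof.
elim: t m => [|a t IH] [|m] /=; try exact: big_geq.
  by rewrite big1 // => j _; rewrite nth_nil.
by rewrite big_nat_recl //= IH.
Qed.

Lemma ribbon_height_count r s i t : (0 < r)%N -> reads r s i t ->
  ribbon_height r s i = count id (take r.-1 (behead t)).
Proof.
move=> r0 /reads_behead st; rewrite /ribbon_height -sum_nth_count.
rewrite big_add1 big_nat_rev; apply: eq_big_nat => j jr /=.
by rewrite -st; congr (nat_of_bool (s _)); lia.
Qed.

Lemma can_add_ribbon_reads r s i t : reads r s i t ->
  can_add_ribbon r s i = head false t && ~~ nth false t r.
Proof.
move=> st; rewrite /can_add_ribbon -nth0 -!st addr0; congr (_ && ~~ s _); lia.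
Qed.

Lemma placement_series_nil r s i m : reads r s i [::] ->
  placement_series r s i m = tail_series 0.
Proof.
elim: m i => [|m IH] i st.
  by apply/funext => -[|n]; rewrite /placement_series /= ?big_seq1 ?big_nil.
rewrite placement_seriesS (can_add_ribbon_reads st) addr0.
by rewrite (IH _ (reads_behead st)).
Qed.

(** A ribbon extends the list to length [r] but lowers [n] by one, so the bound on [m] survives the
    induction. *)
Lemma placement_series_tail r s i t m n : (0 < r)%N -> reads r s i t ->
  (size t <= r)%N -> (size t + n * r <= m)%N ->
  placement_series r s i m n = tail_series (count id t) n.
Proof.
move=> r0; elim: m s i t n => [|m IH] s i [|a t] n st tr //=;
  try by move=> _; rewrite placement_series_nil.
move=> nm; rewrite placement_seriesS (can_add_ribbon_reads st) /=.
have t_n : (size t + n * r <= m)%N by lia.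
have IH1 := IH _ _ _ _ (reads_behead st) (ltnW tr) t_n.
rewrite (@nth_default _ _ _ r) ?andbT; last exact: tr.
rewrite /= in tr; case: a st {IH1} (IH1) => st IH1; last by rewrite addr0 IH1.
rewrite add1n tail_seriesS [LHS]/GRing.add /= IH1; congr (_ + _).
rewrite (ribbon_height_count r0 st) /= take_oversize; last first.
  by rewrite -ltnS prednK.
case: n nm {t_n IH1} => [//|n] nm; rewrite /mulXY; congr (_ * _).
have sz : size (set_nth false t r.-1 true) = r.
  by rewrite size_set_nth prednK //; apply/maxn_idPl; exact: ltnW.
rewrite (IH _ _ _ _ (reads_add_ribbon r0 st)) /= ?sz //; last first.
  by move: nm; rewrite mulSn; lia.
by rewrite count_set_nthF //= nth_default ?subn0 ?addn1 // -ltnS prednK.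
Qed.

Lemma placement_series_window r s i u w m n : (0 < r)%N -> size u = r ->
  reads r s i (u ++ w) -> (size w + r + n * r <= m)%N ->
  placement_series r s i m n = window_series u w n.
Proof.
move=> r0; elim: w s i u m n => [|b w IH] s i u m n su st le_m /=.
  by rewrite cats0 in st; apply: placement_series_tail st _ _ => //; rewrite su.
case: u su st => [|a u] /= su st; first lia.
case: m le_m => [//|m] le_m; have {}le_m : (size w + r + n * r <= m)%N by [].
rewrite placement_seriesS (can_add_ribbon_reads st) /=.
rewrite -su /= nth_cat ltnn subnn /= su.
have stay : placement_series r s (i + 1) m n = window_series (rcons u b) w n.
  apply: IH; rewrite ?size_rcons // cat_rcons; exact: reads_behead st.
case: a st => st /=; last by rewrite addr0.
case: b st stay => st stay /=; first by rewrite addr0.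
rewrite [LHS]/GRing.add [RHS]/GRing.add /= stay; congr (_ + _).
have ru : r.-1 = size u by rewrite -su.
rewrite (ribbon_height_count r0 st) /= ru take_size_cat //.
case: n le_m {stay} => [//|n] le_m; congr (_ * _).
apply: IH; rewrite ?size_rcons //; last by move: le_m; rewrite mulSn; lia.
have := reads_add_ribbon r0 st; rewrite ru /= set_nthE size_cat /=.
rewrite -addSnnS leq_addr take_size_cat // cat_rcons.
by rewrite -[_.+1]addn1 addnC -drop_drop drop_size_cat //= drop0.
Qed.

Lemma R00_window_series w r : (0 < r)%N ->
  R00 w r = window_series (nseq r false) w.
Proof.
move=> r0; apply/funext => n.
rewrite (@R00_placement_series _ _ _ (size w + r + n * r)); last lia.
apply: placement_series_window; rewrite ?size_nseq // => j.
(* The initial window covers the positions [-r] to [-1], where all bits are 0. *)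
rewrite nth_cat size_nseq nth_nseq add0r; case: ltnP => jr /=.
  by have -> : - r%:Z + j%:Z = Negz (r - j).-1 by lia.
by have -> : - r%:Z + j%:Z = (j - r)%N by lia.
Qed.

Theorem claim1p1p2 (r : nat) (r_gt0 : (0 < r)%N) (w : seq bool) :
  R00 w r = R00 (rev w) r.
Proof. by rewrite !R00_window_series // window_series_zero_rev. Qed.
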